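(* Let $(T_1, T_2)$ be a pair of commuting pure contractions on a complex Hilbert space $\mathcal{H}$ with $\dim \mathcal{D}_{T_j} < \infty$ for $j = 1, 2$. Let \[ U = \begin{bmatrix} A & B \\ C & D \end{bmatrix} : \mathcal{D}_{T_1} \oplus \mathcal{D}_{T_2} \to \mathcal{D}_{T_1} \oplus \mathcal{D}_{T_2} \] be a unitary operator satisfying $U(D_{T_1} h, D_{T_2} T_1^* h) = (D_{T_1} T_2^* h, D_{T_2} h)$ for all $h \in \mathcal{H}$, and let \[ \tilde{U} = \begin{bmatrix} D^* & B^* \\ C^* & A^* \end{bmatrix} \] on $\mathcal{D}_{T_2} \oplus \mathcal{D}_{T_1}$. Put $\Psi = \tau_{U^*}$ and $\tilde{\Psi} = \tau_{\tilde{U}^*}$, that is, for $z \in \mathbb{D}$, \[ \Psi(z) = A^* + z C^* (I - z D^* )^{-1} B^* \in \mathcal{B}(\mathcal{D}_{T_1}), \qquad \tilde{\Psi}(z) = D + z C (I - z A)^{-1} B \in \mathcal{B}(\mathcal{D}_{T_2}). \] Let \[ V = \{(z_1, z_2) \in \mathbb{D}^2 : \det(\Psi(z_1) - z_2 I) = 0\}, \qquad \tilde{V} = \{(z_1, z_2) \in \mathbb{D}^2 : \det(\tilde{\Psi}(z_2) - z_1 I) = 0\} \] be the distinguished varieties associated with $(T_1,T_2)$ and with $(T_2,T_1)$, respectively. Then $V = \tilde{V}$.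
   Context: A contraction is a bounded operator $T$ with $\|T\| \le 1$. A contraction $T$ on $\mathcal{H}$ is pure if $\lim_{m\to\infty} \|T^{*m} h\| = 0$ for all $h \in \mathcal{H}$. For a contraction $T$ on $\mathcal{H}$, $D_T = (I_{\mathcal{H}} - T T^* )^{1/2}$ and $\mathcal{D}_T = \overline{\operatorname{ran}}(I_{\mathcal{H}} - T T^* )$. For a unitary $\begin{bmatrix} P & Q \\ R & S\end{bmatrix}$ on $\mathcal{H}_1 \oplus \mathcal{H}_2$, its transfer function is the $\mathcal{B}(\mathcal{H}_1)$-valued analytic function $\tau(z) = P + zQ(I - zS)^{-1}R$ on the open unit disc $\mathbb{D}$. $\mathbb{D}^2 = \mathbb{D}\times\mathbb{D}$. In block matrices, $A \in \mathcal{B}(\mathcal{D}_{T_1})$, $B : \mathcal{D}_{T_2} \to \mathcal{D}_{T_1}$, $C : \mathcal{D}_{T_1}\to\mathcal{D}_{T_2}$, $D \in \mathcal{B}(\mathcal{D}_{T_2})$. A distinguished variety is a non-empty set of the form $V=\{(z_1,z_2)\in\mathbb{D}^2 : q(z_1,z_2)=0\}$, with $q\in\mathbb{C}[z_1,z_2]$, such that $\overline{V}\cap\partial\mathbb{D}^2 = \overline{V}\cap(\partial\mathbb{D}\times\partial\mathbb{D})$. *)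

(* Defs.v *)
From HB Require Import structures.
From mathcomp Require Import all_boot all_order all_algebra sesquilinear complex.
From mathcomp Require Import boolp classical_sets reals topology normedtype.
Set Implicit Arguments.
Unset Strict Implicit.
Unset Printing Implicit Defensive.
Import Order.TTheory GRing.Theory Num.Theory.
Import numFieldNormedType.Exports.
Local Open Scope classical_set_scope.
Local Open Scope ring_scope.

(* The scalars are the complex numbers R[i] over R : realType.  Inner products
   are linear in the first variable and conjugate-linear in the second one. *)
HB.mixin Record hasInner (R : rcfType) E of GRing.Lmodule R[i] E := {
  inner : {dot E for @Num.conj R[i]} }.

#[short(type="innerProductType")]
HB.structure Definition InnerProduct (R : rcfType) :=
  { E of GRing.Lmodule R[i] E & hasInner R E }.

HB.mixin Record inner_norm_compat (R : realType) H
    of CompleteNormedModule R[i] H & InnerProduct R H := {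
  norm_inner : forall x : H, `|x| ^+ 2 = (inner : H -> H -> R[i]) x x }.

#[short(type="hilbertType")]
HB.structure Definition Hilbert (R : realType) :=
  { H of CompleteNormedModule R[i] H & InnerProduct R H
       & inner_norm_compat R H }.

(* Orthogonal direct sum E (+) F of two inner product spaces, carried by the
   product E * F. *)
Section DirectSum.
Variables (R : rcfType) (E F : innerProductType R).

Definition sum_inner (x y : E * F) : R[i] :=
  inner x.1 y.1 + inner x.2 y.2.

Fact sum_inner_linearl y : linear_for *%R (sum_inner ^~ y).
Proof.
by move=> a u v; rewrite /sum_inner /= !linearPl /= mulrDr addrACA.
Qed.

Fact sum_inner_linearr x :
  linear_for (@Num.conj R[i] \; *%R) (sum_inner x).
Proof.
by move=> a u v; rewrite /sum_inner /= !linearPr /= mulrDr addrACA.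
Qed.

HB.instance Definition _ := bilinear_isBilinear.Build _ _ _ _ _ _ sum_inner
  (sum_inner_linearl, sum_inner_linearr).

Fact sum_inner_hermitian x y :
  sum_inner x y = (-1) ^+ false * Num.conj (sum_inner y x).
Proof.
rewrite /sum_inner rmorphD /= expr0 mul1r.
by congr (_ + _); rewrite [LHS]hermC /= expr0 mul1r.
Qed.

HB.instance Definition _ :=
  isHermitianSesquilinear.Build _ _ _ _ sum_inner sum_inner_hermitian.

Fact sum_inner_gt0 u : u != 0 -> 0 < sum_inner u u.
Proof.
case: u => u v; rewrite /sum_inner /= => uv0.
have [u0|u0] := eqVneq u 0; last first.
  by rewrite ltr_wpDr ?dnorm_ge0// dnorm_gt0.
rewrite u0 linear0l add0r dnorm_gt0.
by apply: contraNneq uv0 => ->; rewrite u0.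
Qed.

HB.instance Definition _ := isDotProduct.Build _ _ sum_inner sum_inner_gt0.

HB.instance Definition _ := hasInner.Build R (E * F)%type sum_inner.

End DirectSum.

Section Operators.
Variable R : rcfType.

(* The linear map with property P; the zero map if there is none.  It is only
   used for properties P that determine the map uniquely. *)
Definition the_linear (E F : lmodType R[i]) (P : {linear E -> F} -> Prop) :
    {linear E -> F} :=
  if pselect (exists S, P S) is left e then projT1 (cid e) else \0.

Lemma the_linearP (E F : lmodType R[i]) (P : {linear E -> F} -> Prop) :
  (exists S, P S) -> P (the_linear P).
Proof.
by rewrite /the_linear; case: pselect => // e _; exact: (projT2 (cid e)).
Qed.

(* Exists, by the Riesz representation theorem, when T is a bounded linear map
   on a Hilbert space or a linear map between finite-dimensional spaces. *)
Definition adjoint (E F : innerProductType R) (T : E -> F) : {linear F -> E} :=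
  the_linear (fun S => forall x y, inner (T x) y = inner x (S y)).

Definition unitary_op (E : innerProductType R) (U : E -> E) : Prop :=
  cancel U (adjoint U) /\ cancel (adjoint U) U.

Definition inv_op (E : lmodType R[i]) (T : E -> E) : {linear E -> E} :=
  the_linear (fun S => cancel T S /\ cancel S T).

End Operators.

Section DefectSpace.
Variables (R : realType) (H : hilbertType R) (T : {linear H -> H}).

(* I - T T^* *)
Definition defect_sq (h : H) : H := h - T (adjoint T h).

(* The positive square root of P, unique when it exists; positivity is that of
   the complex order, so <S x, x> is real and nonnegative. *)
Definition sqrt_op (P : H -> H) : {linear H -> H} :=
  the_linear (fun S : {linear H -> H} =>
    [/\ continuous S, forall x, 0 <= inner (S x) x & forall x, S (S x) = P x]).

Definition defect_op : {linear H -> H} := sqrt_op defect_sq.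

(* The closure of ran (I - T T^* ); the record [defect_space] is
   this subspace of H with the restricted inner product. *)
Definition defect_pred : pred H := mem (closure (range defect_sq)).

Fact defect_pred_submod : subsemimod_closed defect_pred.
Proof.
have sqD x y : defect_sq (x + y) = defect_sq x + defect_sq y.
  by rewrite /defect_sq (linearD (adjoint T)) (linearD T) opprD addrACA.
have sqZ a x : defect_sq (a *: x) = a *: defect_sq x.
  by rewrite /defect_sq [adjoint T _]linearZ [T _]linearZ scalerBr.
split=> [|a u]; first split=> [|u v].
- apply/mem_set/subset_closure; exists 0 => //.
  by rewrite /defect_sq !linear0 addr0.
- move=> /set_mem uT /set_mem vT; apply/mem_set => B Buv.
  have [[/= U W] /= [nU nW] UW] :=
    @pseudometric_normed_Zmodule.add_continuous _ H (u, v) B Buv.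
  have [_ [[x _ <-] Ux]] := uT U nU; have [_ [[y _ <-] Wy]] := vT W nW.
  exists (defect_sq (x + y)); split; first by exists (x + y).
  by rewrite sqD; exact: (UW (_, _)).
- move=> /set_mem uT; apply/mem_set => B Bu.
  have [_ [[x _ <-] Bx]] := uT _ (scaler_continuous (k := a) Bu).
  by exists (defect_sq (a *: x)); split; [exists (a *: x)|rewrite sqZ].
Qed.

HB.instance Definition _ :=
  GRing.isSubmodClosed.Build R[i] H defect_pred defect_pred_submod.

Record defect_space := DefectSpace {
  defect_val :> H; _ : defect_val \in defect_pred }.

HB.instance Definition _ := [isSub for defect_val].
HB.instance Definition _ := [Choice of defect_space by <:].
HB.instance Definition _ := [SubChoice_isSubLmodule of defect_space by <:].

Definition sub_inner (x y : defect_space) : R[i] := inner (val x) (val y).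

Fact sub_inner_linearl y : linear_for *%R (sub_inner ^~ y).
Proof. by move=> a u v; rewrite /sub_inner [val _]linearP linearPl. Qed.

Fact sub_inner_linearr x :
  linear_for (@Num.conj R[i] \; *%R) (sub_inner x).
Proof. by move=> a u v; rewrite /sub_inner [val (_ + _)]linearP linearPr. Qed.

HB.instance Definition _ := bilinear_isBilinear.Build _ _ _ _ _ _ sub_inner
  (sub_inner_linearl, sub_inner_linearr).

Fact sub_inner_hermitian x y :
  sub_inner x y = (-1) ^+ false * Num.conj (sub_inner y x).
Proof. exact: hermC. Qed.

HB.instance Definition _ :=
  isHermitianSesquilinear.Build _ _ _ _ sub_inner sub_inner_hermitian.

Fact sub_inner_gt0 u : u != 0 -> 0 < sub_inner u u.
Proof. by move=> u0; rewrite /sub_inner dnorm_gt0. Qed.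

HB.instance Definition _ := isDotProduct.Build _ _ sub_inner sub_inner_gt0.

HB.instance Definition _ := hasInner.Build R defect_space sub_inner.

(* The vector D_T h of the defect space.  For a contraction T,
   ran D_T is contained in the closure of ran (D_T^2), because D_T is
   self-adjoint, so that the default value 0 of insubd is not used. *)
Definition defect_vec (h : H) : defect_space := insubd 0 (defect_op h).

End DefectSpace.

Section FiniteDimension.
Variables (R : rcfType) (E : lmodType R[i]).

Definition finite_dim : Prop :=
  exists n, exists2 phi : E -> 'rV[R[i]]_n, linear phi & bijective phi.

(* The determinant of the matrix of f in any basis of E (the basis is given by
   its coordinate isomorphism phi, and the value does not depend on it). *)
Definition det_op (f : E -> E) : R[i] :=
  xget 1 [set d | exists n (phi : E -> 'rV[R[i]]_n) (psi : 'rV[R[i]]_n -> E),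
    [/\ linear phi, cancel phi psi, cancel psi phi
      & d = \det (\matrix_(i, j) phi (f (psi (delta_mx 0 i))) 0 j)]].

End FiniteDimension.

Section BlockOperators.
Variables (R : rcfType) (E F : innerProductType R).

Definition block_op (A : {linear E -> E}) (B : {linear F -> E})
    (C : {linear E -> F}) (D : {linear F -> F}) (x : E * F) : E * F :=
  (A x.1 + B x.2, C x.1 + D x.2).

(* tau_W(z) = P + z Q (I - z S)^-1 R for the block decomposition
   [P Q; R S] of W. *)
Definition transfer (W : E * F -> E * F) (z : R[i]) (x : E) : E :=
  (W (x, 0)).1 +
  z *: (W (0, inv_op (fun y => y - z *: (W (0, y)).2) (W (x, 0)).2)).1.

End BlockOperators.

Section Contractions.
Variables (R : realType) (H : hilbertType R).

Definition contraction_op (T : {linear H -> H}) : Prop :=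
  forall h, `|T h| <= `|h|.

Definition pure_op (T : {linear H -> H}) : Prop :=
  forall h, (`|iter m (adjoint T) h| : R[i]^o) @[m --> \oo] --> (0 : R[i]^o).

End Contractions.

(* Main.v *)
Require Import Defs.
From HB Require Import structures.
From mathcomp Require Import all_boot all_order all_algebra sesquilinear complex.
From mathcomp Require Import boolp classical_sets reals topology normedtype.
Import Order.TTheory GRing.Theory Num.Theory.
Import numFieldNormedType.Exports.
Local Open Scope classical_set_scope.
Local Open Scope ring_scope.

(** For (z1, z2) in the bidisc, membership in either variety is a condition on
    the unitary U alone:

      U (z2 x, y) = (x, z1 y) for some (x, y) <> 0.

    A zero of det (Psi(z1) - z2 I) is an eigenvector x of Psi(z1) for the
    eigenvalue z2.  The resolvent in the transfer function Psi of U^* disappears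
    when y = (I - z1 D^* )^-1 B^* x is kept as a second unknown: the eigenvalue
    equation becomes the linear system U^* (x, z1 y) = (z2 x, y)
    ([det_transfer_eq0]).  The system and the equation have nonzero solutions for
    the same (z1, z2) because a corner of an isometry is a contraction, so that
    I - z1 D^* is invertible for |z1| < 1 ([isometry_corner_lt1]).

    The same lemma applies to the transfer function of the adjoint of U', which
    is U with the two summands exchanged ([adjoint_swapped_block]), and gives the
    system U (z2 x, y) = (x, z1 y).  Since U^* is the inverse of U, the two
    systems are the same ([det_transfer_swap]). *)

(** * Linear algebra on a finite-dimensional space *)

Section FiniteDimensionalEndomorphisms.
Set Implicit Arguments.
Unset Strict Implicit.
Variables (R : rcfType) (E : lmodType R[i]) (f : {linear E -> E}).

Let mx_of n (phi : E -> 'rV[R[i]]_n) (psi : 'rV[R[i]]_n -> E) : 'M[R[i]]_n :=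
  \matrix_(i, j) phi (f (psi (delta_mx 0 i))) 0 j.

Let linear_at0 n (phi : E -> 'rV[R[i]]_n) : linear phi -> phi 0 = 0.
Proof. by move=> /(_ (-1) 0 0); rewrite scaler0 addr0 scaleN1r addNr. Qed.

Let mul_mx_of n (phi : E -> 'rV[R[i]]_n) psi (u : 'rV[R[i]]_n) :
  linear phi -> cancel phi psi -> cancel psi phi ->
  u *m mx_of phi psi = phi (f (psi u)).
Proof.
move=> phiL phiK psiK.
have psiL : linear psi.
  by move=> a v w; apply: (can_inj phiK); rewrite psiK phiL !psiK.
have gL : linear (fun v => phi (f (psi v))).
  by move=> a v w; rewrite psiL linearP phiL.
pose gM := GRing.isLinear.Build _ _ _ _ _ gL.
pose g : {linear 'rV[R[i]]_n -> 'rV[R[i]]_n} :=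
  HB.pack (fun v => phi (f (psi v))) gM.
rewrite -[RHS]/(g u) -(mul_rV_lin1 g); congr (_ *m _).
by apply/matrixP => i j; rewrite !mxE.
Qed.

(** In any coordinates the matrix of [f] is singular exactly when [f] has a
    kernel, so the coordinates that [det_op] selects do not matter. *)
Lemma det_op_eq0 : finite_dim E ->
  det_op f = 0 <-> exists2 x, x != 0 & f x = 0.
Proof.
move=> [n0 [phi0 phi0L [psi0 phi0K psi0K]]].
rewrite /det_op; case: xgetP => [d _ [n [phi [psi [phiL phiK psiK ->]]]]|nP].
  have phi0' := linear_at0 phiL.
  have psi0' : psi 0 = 0 by rewrite -phi0' phiK.
  rewrite -/(mx_of phi psi); split=> [/eqP/det0P[u u0 uM]|[x x0 fx]].
    exists (psi u).
      by apply: contraNneq u0 => pu; rewrite -(psiK u) pu phi0'.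
    by apply: (can_inj phiK); rewrite -mul_mx_of// phi0'.
  apply/eqP/det0P; exists (phi x).
    by apply: contraNneq x0 => px; rewrite -(phiK x) px psi0'.
  by rewrite mul_mx_of// phiK fx.
(* By finite dimension the default value of [xget] is not reached. *)
case: (nP (\det (mx_of phi0 psi0))).
by exists n0, phi0, psi0; split.
Qed.

(** Injectivity suffices because the coordinate matrix is square. *)
Lemma inv_opP : finite_dim E -> (forall x, f x = 0 -> x = 0) ->
  cancel f (inv_op f) /\ cancel (inv_op f) f.
Proof.
move=> [n [phi phiL [psi phiK psiK]]] f0.
have phi0 := linear_at0 phiL.
have psi0 : psi 0 = 0 by rewrite -phi0 phiK.
have Mu : mx_of phi psi \in unitmx.
  rewrite unitmxE unitfE; apply/negP => /det0P[u /eqP u0]; apply: contra_not u0.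
  rewrite mul_mx_of// => pf; rewrite -(psiK u) (f0 (psi u)) ?phi0//.
  by rewrite -(phiK (f _)) pf psi0.
pose g y := psi (phi y *m invmx (mx_of phi psi)).
have gK : cancel f g.
  by move=> x; rewrite /g -{1}(phiK x) -mul_mx_of// mulmxK// phiK.
have fK : cancel g f.
  by move=> y; apply: (can_inj phiK); rewrite /g -mul_mx_of// mulmxKV.
have gL : linear g.
  by move=> a v w; apply: (can_inj gK); rewrite linearP !fK.
pose gM := GRing.isLinear.Build _ _ _ _ _ gL.
pose gl : {linear E -> E} := HB.pack g gM.
by apply: (the_linearP (P := fun S => cancel f S /\ cancel S f)); exists gl.
Qed.

End FiniteDimensionalEndomorphisms.

(** * Adjoints and orthogonal sums *)

Section Adjoints.
Set Implicit Arguments.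
Unset Strict Implicit.
Variables (R : rcfType) (E F : innerProductType R).

Lemma inner_herm (G : innerProductType R) (x y : G) :
  inner x y = Num.conj (inner y x).
Proof. by rewrite [LHS]hermC /= expr0 mul1r. Qed.

Lemma inner_inj (x y : E) : (forall u, inner u x = inner u y) -> x = y.
Proof.
move=> xy; apply/eqP; rewrite -subr_eq0; apply/negPn/negP => xy0.
have : 0 < inner (x - y) (x - y) by rewrite dnorm_gt0.
by rewrite linearBr /= xy subrr ltxx.
Qed.

Lemma adjoint_inner (T : E -> F) (S : {linear F -> E}) :
  (forall x y, inner (T x) y = inner x (S y)) ->
  forall x y, inner (T x) y = inner x (adjoint T y).
Proof.
move=> TS; apply: (the_linearP
  (P := fun S => forall x y, inner (T x) y = inner x (S y))).
by exists S.
Qed.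

Lemma adjoint_eq (T : E -> F) (S : {linear F -> E}) :
  (forall x y, inner (T x) y = inner x (S y)) -> adjoint T =1 S.
Proof.
by move=> TS y; apply: inner_inj => x; rewrite -(adjoint_inner TS) TS.
Qed.

Lemma adjoint_inner_sym (T : E -> F) :
  (forall x y, inner (T x) y = inner x (adjoint T y)) ->
  forall y x, inner (adjoint T y) x = inner y (T x).
Proof. by move=> Tadj y x; rewrite inner_herm -Tadj -inner_herm. Qed.

Lemma innerZZ (z : R[i]) (x : E) :
  inner (z *: x) (z *: x) = `|z| ^+ 2 * inner x x.
Proof. by rewrite linearZl_LR linearZr_LR /= mulrA normCK. Qed.

End Adjoints.

Section PairInner.
Set Implicit Arguments.
Unset Strict Implicit.
Variables (R : rcfType) (E F : innerProductType R).

Lemma pair_innerE (u v : (E * F)%type) :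
  inner u v = inner u.1 v.1 + inner u.2 v.2.
Proof. by []. Qed.

Lemma block_op_linear (A : {linear E -> E}) (B : {linear F -> E})
  (C : {linear E -> F}) (D : {linear F -> F}) : linear (block_op A B C D).
Proof.
move=> a u v; apply/pair_equal_spec.
by rewrite /block_op /= !linearP !scalerDr; split; rewrite addrACA.
Qed.

End PairInner.

(** * Zeros of the transfer function of an isometry *)

Section Transfer.
Set Implicit Arguments.
Unset Strict Implicit.
Variables (R : rcfType) (E F : innerProductType R).
Variable (W : {linear (E * F)%type -> (E * F)%type}).

Lemma transfer_linear (z : R[i]) : linear (transfer W z).
Proof.
have Wl a (x y : E) : W (a *: x + y, 0) = a *: W (x, 0) + W (y, 0).
  rewrite -linearP; congr (W (_, _)) => //=.
  by rewrite scaler0 addr0.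
have Wr a (x y : F) : W (0, a *: x + y) = a *: W (0, x) + W (0, y).
  rewrite -linearP; congr (W (_, _)) => //=.
  by rewrite scaler0 addr0.
move=> a x y; rewrite /transfer Wl /= linearP Wr /= !scalerDr !scalerA (mulrC a).
by rewrite addrACA.
Qed.

Hypothesis W_isometry : forall x, inner (W x) (W x) = inner x x.

(** The lower right corner S of an isometry is a contraction: if y = z S y with
    |z| < 1 and y <> 0, then |y| = |z| |S y| <= |z| |y| < |y|.  Hence I - z S is
    injective on the open disc. *)
Lemma isometry_corner_lt1 (z : R[i]) (y : F) : `|z| < 1 ->
  y - z *: (W (0, y)).2 = 0 -> y = 0.
Proof.
move=> z1 /eqP; rewrite subr_eq0 => /eqP yz; apply/eqP/negPn/negP => y0.
have wy : inner (W (0, y)).2 (W (0, y)).2 <= inner y y.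
  have := W_isometry (0, y); rewrite /inner /= /sum_inner /= linear0l add0r => <-.
  by rewrite lerDr dnorm_ge0.
have y_gt0 : 0 < inner y y by rewrite dnorm_gt0.
have : inner y y < inner y y; last by rewrite ltxx.
rewrite {1 2}yz innerZZ; apply: (@le_lt_trans _ _ (`|z| ^+ 2 * inner y y)).
  by rewrite ler_wpM2l// exprn_ge0.
by rewrite gtr_pMl// exprn_ilt1.
Qed.

(** Linearization of the eigenvalue equation.  Write W = [P Q; R S] and
    tau(z) x = P x + z Q y with y = (I - z S)^-1 R x, that is, y = R x + z S y.
    Then tau(z) x = w x together with the equation defining y reads
    W (x, z y) = (w x, y).  A nonzero solution (x, y) of this has x <> 0, since
    x = 0 gives y = z S y and so y = 0. *)
Lemma det_transfer_eq0 (z w : R[i]) :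
  finite_dim E -> finite_dim F -> `|z| < 1 ->
  det_op (fun x => transfer W z x - w *: x) = 0 <->
  exists2 u : (E * F)%type, u != 0 & W (u.1, z *: u.2) = (w *: u.1, u.2).
Proof.
move=> finE finF z1.
have Wsplit x y : W (x, y) = W (x, 0) + W (0, y).
  by rewrite -linearD; congr (W (_, _)); rewrite /= ?addr0 ?add0r.
have WZ y : W (0, z *: y) = z *: W (0, y).
  by rewrite -linearZ; congr (W (_, _)); rewrite /= scaler0.
have fL : linear (fun x => transfer W z x - w *: x).
  move=> a x y; rewrite transfer_linear scalerBr [w *: (_ + _)]scalerDr.
  by rewrite opprD addrACA !scalerA (mulrC w).
have gL : linear (fun y => y - z *: (W (0, y)).2).
  move=> a x y; have -> : W (0, a *: x + y) = a *: W (0, x) + W (0, y).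
    by rewrite -linearP; congr (W (_, _)); rewrite /= scaler0 addr0.
  by rewrite /= scalerBr [z *: (_ + _)]scalerDr opprD addrACA !scalerA (mulrC z).
pose fM := GRing.isLinear.Build _ _ _ _ _ fL.
pose f : {linear E -> E} := HB.pack (fun x => transfer W z x - w *: x) fM.
pose gM := GRing.isLinear.Build _ _ _ _ _ gL.
pose g : {linear F -> F} := HB.pack (fun y => y - z *: (W (0, y)).2) gM.
have [gK Kg] := inv_opP (f := g) finF (fun y => isometry_corner_lt1 z1).
rewrite (det_op_eq0 f finE); split=> [[x x0 /eqP]|[[x y] /= u0 Wu]].
  rewrite subr_eq0 => /eqP fx.
  pose y := inv_op g (W (x, 0)).2.
  have gy : y - z *: (W (0, y)).2 = (W (x, 0)).2 by exact: Kg.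
  exists (x, y); first by apply: contraNneq x0 => -[->].
  rewrite (Wsplit x) WZ /= -fx; apply/pair_equal_spec; split=> //=.
  by rewrite -gy subrK.
have E1 : (W (x, 0)).1 + z *: (W (0, y)).1 = w *: x.
  by rewrite -[RHS]/(w *: x, y).1 -Wu (Wsplit x (z *: y)) WZ.
have E2 : g y = (W (x, 0)).2.
  apply/eqP; rewrite /= subr_eq -[X in X == _]/(w *: x, y).2 -Wu.
  by rewrite (Wsplit x (z *: y)) WZ.
exists x; last first.
  by apply/eqP; rewrite subr_eq0 -E1 /transfer -E2 gK.
apply: contraNneq u0 => x0; rewrite x0; apply/eqP/pair_equal_spec; split=> //.
apply: (isometry_corner_lt1 z1); rewrite -[LHS]/(g y) E2 x0.
by rewrite (linear0 W).
Qed.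

End Transfer.

(** * Unitary operators and their blocks *)

Section Unitary.
Set Implicit Arguments.
Unset Strict Implicit.
Variables (R : rcfType) (E : innerProductType R) (U : E -> E).
Hypothesis U_unitary : unitary_op U.

(** If [U] had no adjoint, [adjoint U] would be the default value 0; as it
    inverts [U], the space would be zero, where 0 is an adjoint of [U]. *)
Lemma unitary_adjoint x y : inner (U x) y = inner x (adjoint U y).
Proof.
have [UK KU] := U_unitary; move: x y.
have [[S US]|noS] := pselect (exists S : {linear E -> E},
    forall x y, inner (U x) y = inner x (S y)); first exact: (adjoint_inner US).
have U0 : adjoint U = \0 :> {linear E -> E}.
  by rewrite /adjoint /the_linear; case: pselect.
have E0 (x : E) : x = 0 by rewrite -(UK x) U0.
by move=> x y; rewrite (E0 x) (E0 (U 0)) !linear0l.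
Qed.

Lemma unitary_isometry x : inner (U x) (U x) = inner x x.
Proof. by rewrite unitary_adjoint U_unitary.1. Qed.

Lemma adjoint_unitary_isometry x :
  inner (adjoint U x) (adjoint U x) = inner x x.
Proof. by rewrite -unitary_adjoint U_unitary.2. Qed.

End Unitary.

Section Blocks.
Set Implicit Arguments.
Unset Strict Implicit.
Variables (R : rcfType) (E F : innerProductType R).
Variables (A : {linear E -> E}) (B : {linear F -> E}).
Variables (C : {linear E -> F}) (D : {linear F -> F}).
Let U := block_op A B C D.
Let U' := block_op (adjoint D) (adjoint B) (adjoint C) (adjoint A).
Hypothesis U_unitary : unitary_op U.

(** The blocks have adjoints because [U] has one: the adjoints of the blocks are
    the blocks of the adjoint of [U]. *)
Lemma block_adjoint :
  [/\ forall x y, inner (A x) y = inner x (adjoint A y),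
      forall x y, inner (B x) y = inner x (adjoint B y),
      forall x y, inner (C x) y = inner x (adjoint C y)
    & forall x y, inner (D x) y = inner x (adjoint D y)].
Proof.
have inlL : linear (fun x : E => (x, 0 : F)).
  by move=> a x y; apply/pair_equal_spec; split; rewrite /= ?scaler0 ?addr0.
have inrL : linear (fun y : F => (0 : E, y)).
  by move=> a x y; apply/pair_equal_spec; split; rewrite /= ?scaler0 ?addr0.
pose inlM := GRing.isLinear.Build _ _ _ _ _ inlL.
pose inl' : {linear E -> (E * F)%type} := HB.pack (fun x : E => (x, 0 : F)) inlM.
pose inrM := GRing.isLinear.Build _ _ _ _ _ inrL.
pose inr' : {linear F -> (E * F)%type} := HB.pack (fun y : F => (0 : E, y)) inrM.
have Uadj := unitary_adjoint U_unitary.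
split.
- apply: (adjoint_inner (S := fst \o adjoint U \o inl')) => x y.
  have := Uadj (x, 0) (y, 0).
  by rewrite !pair_innerE /= !linear0 ?linear0l ?linear0r !addr0.
- apply: (adjoint_inner (S := snd \o adjoint U \o inl')) => x y.
  have := Uadj (0, x) (y, 0).
  by rewrite !pair_innerE /= !linear0 ?linear0l ?linear0r !(addr0, add0r).
- apply: (adjoint_inner (S := fst \o adjoint U \o inr')) => x y.
  have := Uadj (x, 0) (0, y).
  by rewrite !pair_innerE /= !linear0 ?linear0l ?linear0r !(addr0, add0r).
- apply: (adjoint_inner (S := snd \o adjoint U \o inr')) => x y.
  have := Uadj (0, x) (0, y).
  by rewrite !pair_innerE /= !linear0 ?linear0l ?linear0r !(addr0, add0r).
Qed.

Let Ud := block_op D C B A.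

(** Up to exchanging the two summands, the adjoint of the operator [U'] is [U]
    itself. *)
Lemma adjoint_swapped_block : adjoint U' =1 Ud.
Proof.
have [Aadj Badj Cadj Dadj] := block_adjoint.
pose SM := GRing.isLinear.Build _ _ _ _ _ (block_op_linear D C B A).
pose S : {linear (F * E)%type -> (F * E)%type} :=
  HB.pack (block_op D C B A) SM.
apply: (adjoint_eq (S := S)) => -[y x] [y' x'].
rewrite !pair_innerE /= !linearDl !linearDr /=.
rewrite !(adjoint_inner_sym Aadj) !(adjoint_inner_sym Badj).
rewrite !(adjoint_inner_sym Cadj) !(adjoint_inner_sym Dadj).
by rewrite addrACA [inner x (B y') + _]addrC.
Qed.

Lemma adjoint_swapped_isometry v :
  inner (adjoint U' v) (adjoint U' v) = inner v v.
Proof.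
have := unitary_isometry U_unitary (v.2, v.1).
rewrite adjoint_swapped_block !pair_innerE /= addrC => UE.
by rewrite [RHS]addrC -UE [D _ + _]addrC [B _ + _]addrC.
Qed.

(** The left-hand side asks for (x, y) <> 0 with U^* (x, z1 y) = (z2 x, y), the
    right-hand side for (y, x) <> 0 with U (z2 x, y) = (x, z1 y).  These two
    equations are equivalent because U^* is the inverse of U. *)
Lemma det_transfer_swap (z1 z2 : R[i]) :
  finite_dim E -> finite_dim F -> `|z1| < 1 -> `|z2| < 1 ->
  det_op (fun x => transfer (adjoint U) z1 x - z2 *: x) = 0 <->
  det_op (fun y => transfer (adjoint U') z2 y - z1 *: y) = 0.
Proof.
move=> finE finF lt1 lt2; have [UK KU] := U_unitary.
rewrite (det_transfer_eq0 (adjoint_unitary_isometry U_unitary))//.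
rewrite (det_transfer_eq0 adjoint_swapped_isometry)//.
have swap0 (E1 E2 : innerProductType R) (x : E1) (y : E2) :
    (x, y) != 0 -> (y, x) != 0.
  by apply: contraNneq => -[-> ->].
have swapE x y : adjoint U' (y, x) = ((U (x, y)).2, (U (x, y)).1).
  by rewrite adjoint_swapped_block /Ud /U /block_op /= [D y + _]addrC [B y + _]addrC.
split=> -[[x y] u0 eq_xy]; exists (y, x); do ?exact: swap0.
  have UE : U (z2 *: x, y) = (x, z1 *: y) by rewrite -[RHS]KU eq_xy.
  by rewrite [LHS]swapE UE.
have UE : U (z2 *: y, x) = (y, z1 *: x).
  have /pair_equal_spec[E2 E1] := etrans (esym eq_xy) (swapE (z2 *: y) x).
  by rewrite [LHS]surjective_pairing -E2 -E1.
by rewrite -[RHS]UK UE.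
Qed.

End Blocks.

Theorem mainTheorem4 (R : realType) (H : hilbertType R)
    (T1 T2 : {linear H -> H})
    (A : {linear defect_space T1 -> defect_space T1})
    (B : {linear defect_space T2 -> defect_space T1})
    (C : {linear defect_space T1 -> defect_space T2})
    (D : {linear defect_space T2 -> defect_space T2}) :
  contraction_op T1 -> contraction_op T2 -> pure_op T1 -> pure_op T2 ->
  (forall h, T1 (T2 h) = T2 (T1 h)) ->
  finite_dim (defect_space T1) -> finite_dim (defect_space T2) ->
  let U := block_op A B C D in
  unitary_op U ->
  (forall h, U (defect_vec T1 h, defect_vec T2 (adjoint T1 h)) =
             (defect_vec T1 (adjoint T2 h), defect_vec T2 h)) ->
  let U' := block_op (adjoint D) (adjoint B) (adjoint C) (adjoint A) in
  let Psi := transfer (adjoint U) in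
  let Psi' := transfer (adjoint U') in
  let V := [set z : R[i] * R[i] | [/\ `|z.1| < 1, `|z.2| < 1 &
              det_op (fun x => Psi z.1 x - z.2 *: x) = 0]] in
  let V' := [set z : R[i] * R[i] | [/\ `|z.1| < 1, `|z.2| < 1 &
              det_op (fun y => Psi' z.2 y - z.1 *: y) = 0]] in
  V = V'.
Proof.
move=> _ _ _ _ _ finD1 finD2 U U_unitary _ U' Psi Psi' V V'.
apply/seteqP; split=> -[z1 z2] /= [lt1 lt2 detz]; split=> //; move: detz.
  exact: (det_transfer_swap U_unitary finD1 finD2 lt1 lt2).1.
exact: (det_transfer_swap U_unitary finD1 finD2 lt1 lt2).2.
Qed.
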